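(* For the DRB game in the $k$-dimensional grid, the navigable small-world network ($\mathbf r\equiv k$) and the random small-world network ($\mathbf r\equiv 0$) are the two strict Nash equilibria for sufficiently large $n$, and there are no other uniform Nash equilibria (i.e. for no $s\in\Sigma\setminus\{0,k\}$ is the profile $\mathbf r\equiv s$ a Nash equilibrium).
   Context: DRB (Distance-Reciprocity Balanced) game. Fix an integer $k\ge 1$ and $\gamma=1/g$ with $g\ge 2$ an integer. For an integer $n\ge 2$ let $V=\{1,\dots,n\}^k$, viewed as a torus grid with distance $d_M(u,v)=\sum_{i=1}^k\min\{|u_i-v_i|,\,n-|u_i-v_i|\}$. Each node $u\in V$ is a player with strategy $r_u\in\Sigma=\{0,\gamma,2\gamma,3\gamma,\dots\}$ and a constant exponent $\alpha_u>0$ (possibly different for different nodes). For $r\ge 0$ let $c(r)=\sum_{v\ne u}d_M(u,v)^{-r}$ (independent of $u$) and $p_u(v,r)=d_M(u,v)^{-r}/c(r)$ for $v\neq u$. The payoff of $u$ under the strategy profile $\mathbf r=(r_v)_{v\in V}$ is $$\pi_u(r_u,\mathbf r_{-u})=\Big(\sum_{v\ne u}p_u(v,r_u)\,d_M(u,v)\Big)^{\alpha_u}\Big(\sum_{v\ne u}p_u(v,r_u)\,p_v(u,r_v)\Big).$$ $\mathbf r\equiv s$ means $r_u=s$ for all $u\in V$; such a profile is called uniform. A strategy $r_u^*\in\Sigma$ is a best response to $\mathbf r_{-u}$ if $\pi_u(r_u^*,\mathbf r_{-u})\ge\pi_u(r_u,\mathbf r_{-u})$ for all $r_u\in\Sigma$;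 it is the unique best response if the inequality is strict for all $r_u\neq r_u^*$. A Nash equilibrium is a profile in which each $r_u$ is a best response to $\mathbf r_{-u}$; it is strict if each $r_u$ is the unique best response. A statement being true ''for sufficiently large $n$'' means that there exists a constant $n_0\in\mathbb N$, which may only depend on model constants such as $k$, $\gamma$ and $\alpha_u$, such that for all $n\ge n_0$ the statement is true in the grid with parameter $n$.
   Formalization: The exponents α_u are assumed to lie in a fixed interval [α_min, α_max] with α_min > 0, and n_0 depends only on k, γ, α_min and α_max; for exponents unbounded as the grid grows the claim can fail. *)

(* Defs.v *)
From HB Require Import structures.
From mathcomp Require Import all_boot all_order all_algebra.
From mathcomp Require Import all_classical all_reals all_analysis.

Set Implicit Arguments.
Unset Strict Implicit.
Unset Printing Implicit Defensive.

Import Order.TTheory GRing.Theory Num.Theory.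

Local Open Scope classical_set_scope.
Local Open Scope ring_scope.

(* Coordinates range over {0, ..., n-1} instead of {1, ..., n}: only their
   differences are ever used. *)
Notation node k n := {ffun 'I_k -> 'I_n}.

Definition torus_dist (k n : nat) (u v : node k n) : nat :=
  (\sum_(i < k) minn `|u i - v i| (n - `|u i - v i|))%N.

Section DRBGame.

Variables (R : realType) (k n : nat).

Implicit Types (u v : node k n) (x y : R) (r : node k n -> R).

(* Does not depend on u, by translation invariance of the torus. *)
Definition norm_const u x : R :=
  \sum_(v | v != u) (torus_dist u v)%:R `^ (- x).

Definition link_prob u v x : R :=
  (torus_dist u v)%:R `^ (- x) / norm_const u x.

Definition strategies (gamma : R) : set R :=
  [set x | exists j : nat, x = j%:R * gamma].

(* The payoff of u when it plays x against r; the value r u is not used, so r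
   stands for its restriction to the other players. *)
Definition payoff (alpha : node k n -> R) u x r : R :=
  (\sum_(v | v != u) link_prob u v x * (torus_dist u v)%:R) `^ alpha u *
  (\sum_(v | v != u) link_prob u v x * link_prob v u (r v)).

Definition best_response (gamma : R) (alpha : node k n -> R) r u x : Prop :=
  strategies gamma x /\
  forall y, strategies gamma y -> payoff alpha u y r <= payoff alpha u x r.

Definition unique_best_response (gamma : R) (alpha : node k n -> R) r u x :
    Prop :=
  best_response gamma alpha r u x /\
  forall y, strategies gamma y -> y <> x ->
    payoff alpha u y r < payoff alpha u x r.

Definition nash (gamma : R) (alpha : node k n -> R) r : Prop :=
  forall u, best_response gamma alpha r u (r u).

Definition strict_nash (gamma : R) (alpha : node k n -> R) r : Prop :=
  nash gamma alpha r /\ forall u, unique_best_response gamma alpha r u (r u).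

Definition uniform_profile (s : R) : node k n -> R := fun=> s.

End DRBGame.

Arguments uniform_profile {R} k n s.

(* Main.v *)
(* Let c(x) be the sum of d^(-x) over the distances d from a node. Against the
   uniform profile s, playing x earns
     (c(x - 1) / c(x))^alpha * (c(x + s) / c(x)) / c(s).
   For s = 0 this is a constant times a power of the mean link length, which
   decreases strictly in x by Chebyshev's sum inequality. For s > 0, write
   gamma = 1/g and N for the side of the grid. Playing k earns at least
   N^alpha up to powers of c(k), and c(k) is polylogarithmic in N. Playing
   x <= k - gamma loses a factor N^gamma in c(x + s) / c(x), which is at most
   c(k) / c(k - gamma) by log-convexity of c; playing x >= k + gamma loses
   N^(gamma * alpha) in the mean link length, because
   c(x - 1) <= c(k - (1 - gamma)) <= (k N)^(1 - gamma) c(k). Hence, for large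
   N, k beats every other strategy against every uniform profile s > 0. *)

Require Import Defs.
From HB Require Import structures.
From mathcomp Require Import all_boot all_order all_algebra.
From mathcomp Require Import all_classical all_reals all_analysis.
From mathcomp Require Import zify ring lra.

Set Implicit Arguments.
Unset Strict Implicit.
Unset Printing Implicit Defensive.

Import Order.TTheory GRing.Theory Num.Theory.

Local Open Scope ring_scope.

(** * The torus metric: translation invariance, bounds and attained values *)

Section TorusDistance.

Variables (k m : nat).
Implicit Types (a b : 'I_m.+1) (u v w : node k m.+1).

(** Reduction modulo the side sends the gap to itself or to its complement, and the minimum is
    symmetric under that swap. The distance thus depends only on a difference in the cyclic group
    ['I_m.+1]. *)
Lemma circle_distE a b :
  minn `|a - b|%N (m.+1 - `|a - b|%N) =
  minn (val (b - a)) (m.+1 - val (b - a)).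
Proof.
have am := ltn_ord a; have bm := ltn_ord b.
have -> : val (b - a) = ((b + (m.+1 - a)) %% m.+1)%N by rewrite /= modnDmr.
have [ab|ba] := leqP a b.
- rewrite distnEr // addnBA ?(ltnW am) // -addnC -addnBA // modnDl.
  rewrite modn_small //.
  lia.
- rewrite distnEl 1?ltnW // modn_small; last lia.
  rewrite minnC; congr minn; lia.
Qed.

Lemma torus_distE u v :
  torus_dist u v =
  (\sum_(i < k) minn (val (v i - u i)%R) (m.+1 - val (v i - u i)%R))%N.
Proof. by apply: eq_bigr => i _; rewrite circle_distE. Qed.

Lemma torus_dist_transl w u v :
  torus_dist (u + w) (v + w) = torus_dist u v.
Proof.
rewrite !torus_distE; apply: eq_bigr => i _.
by rewrite !ffunE opprD addrACA subrr addr0.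
Qed.

Lemma torus_distC u v : torus_dist u v = torus_dist v u.
Proof. by apply: eq_bigr => i _; rewrite distnC. Qed.

Lemma torus_dist_ge (i : 'I_k) u v :
  (minn `|u i - v i| (m.+1 - `|u i - v i|) <= torus_dist u v)%N.
Proof. by rewrite /torus_dist (bigD1 i) //= leq_addr. Qed.

Lemma torus_dist_gt0 u v : v != u -> (0 < torus_dist u v)%N.
Proof.
move=> vu; have [i ui] : exists i, v i != u i.
  apply/existsP; rewrite -negb_forall; apply: contra vu => /forallP h.
  by apply/eqP/ffunP => i; apply/eqP.
apply: leq_trans (torus_dist_ge i u v).
have := ltn_ord (u i); have := ltn_ord (v i).
have : nat_of_ord (v i) <> u i by move=> h; case/eqP: ui; apply: val_inj.
lia.
Qed.

Lemma torus_dist_le u v : (torus_dist u v <= k * m.+1)%N.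
Proof.
rewrite -[X in (_ <= X * _)%N]card_ord -sum_nat_const; apply: leq_sum => i _.
by rewrite geq_min leq_subr orbT.
Qed.

(** Shift [u] by [d] along one axis: a step of at most half the side is not shortened by wrapping
    around. *)
Lemma torus_dist_attained u d : (0 < k)%N -> (0 < d)%N -> (d.*2 <= m.+1)%N ->
  exists2 v, v != u & torus_dist u v = d.
Proof.
move=> k0 d0 dm; pose j := Ordinal k0.
pose e : node k m.+1 := [ffun i => if i == j then inord d else 0].
have dE : torus_dist u (u + e) = d.
  rewrite torus_distE (bigD1 j) // big1 ?addn0 => [|i /negbTE ij].
    have -> : (u + e) j - u j = inord d by rewrite !ffunE eqxx addrC addKr.
    by rewrite /= inordK; lia.
  have -> : (u + e) i - u i = 0 by rewrite !ffunE ij addr0 subrr.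
  by rewrite min0n.
exists (u + e) => //; apply: contraTneq d0 => uE.
by rewrite -dE uE torus_distE big1 // => i _; rewrite subrr min0n.
Qed.

End TorusDistance.

(** * Weighted Chebyshev sum inequality *)

Section Chebyshev.

Variables (R : realType) (I : finType) (P : pred I) (w f g : I -> R).

Lemma chebyshev_identity :
  \sum_(i | P i) \sum_(j | P j) w i * w j * ((f i - f j) * (g i - g j)) =
  2 * ((\sum_(i | P i) w i) * (\sum_(i | P i) w i * (f i * g i)) -
       (\sum_(i | P i) w i * f i) * (\sum_(i | P i) w i * g i)).
Proof.
have dbl F G : (\sum_(i | P i) F i) * (\sum_(j | P j) G j) =
    \sum_(i | P i) \sum_(j | P j) F i * G j :> R.
  by rewrite big_distrl; apply: eq_bigr => i _; rewrite big_distrr.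
(* Splitting the factor 2 into two swapped copies makes both sides agree term by term once [dbl]
   expands the products. *)
have -> (a b c d : R) : 2 * (a * b - c * d) = a * b + b * a - (c * d + d * c).
  by ring.
rewrite !dbl -!big_split -sumrB; apply: eq_bigr => i _.
by rewrite -!big_split -sumrB; apply: eq_bigr => j _ /=; ring.
Qed.

Hypothesis w_ge0 : forall i, P i -> 0 <= w i.
Hypothesis fg_ge0 :
  forall i j, P i -> P j -> 0 <= (f i - f j) * (g i - g j).

Lemma chebyshev_sum_le :
  (\sum_(i | P i) w i * f i) * (\sum_(i | P i) w i * g i) <=
  (\sum_(i | P i) w i) * (\sum_(i | P i) w i * (f i * g i)).
Proof.
rewrite -subr_ge0 -(pmulr_rge0 _ (ltr0Sn R 1)) -chebyshev_identity.
apply: sumr_ge0 => i Pi; apply: sumr_ge0 => j Pj.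
by rewrite mulr_ge0 ?fg_ge0 // mulr_ge0 ?w_ge0.
Qed.

(** One strictly positive term in the double sum suffices, all the others being nonnegative. *)
Lemma chebyshev_sum_lt i j : P i -> P j -> 0 < w i -> 0 < w j ->
    0 < (f i - f j) * (g i - g j) ->
  (\sum_(i | P i) w i * f i) * (\sum_(i | P i) w i * g i) <
  (\sum_(i | P i) w i) * (\sum_(i | P i) w i * (f i * g i)).
Proof.
move=> Pi Pj wi wj fgij.
have t_ge0 l l' : P l -> P l' ->
    0 <= w l * w l' * ((f l - f l') * (g l - g l')).
  by move=> Pl Pl'; rewrite mulr_ge0 ?fg_ge0 // mulr_ge0 ?w_ge0.
rewrite -subr_gt0 -(pmulr_rgt0 _ (ltr0Sn R 1)) -chebyshev_identity.
rewrite (bigD1 i) //= ltr_wpDr //.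
  by apply: sumr_ge0 => l /andP[Pl _]; apply: sumr_ge0 => l' Pl'; apply: t_ge0.
rewrite (bigD1 j) //= ltr_wpDr ?(mulr_gt0 _ fgij) ?mulr_gt0 //.
by apply: sumr_ge0 => l /andP[Pl _]; apply: t_ge0.
Qed.

End Chebyshev.

(** * The sum c(x): link with the payoff, log-convexity, growth *)

Section NormConst.

Variables (R : realType) (k m : nat).
Implicit Types (u v w : node k m.+1) (x y p q : R).

Lemma norm_const_transl u v x : norm_const u x = norm_const v x.
Proof.
rewrite /norm_const (reindex_inj (addIr (u - v))) /=.
have uE : u = v + (u - v) by rewrite addrC subrK.
apply: eq_big => [w|w _]; first by rewrite [X in _ != X]uE (inj_eq (addIr _)).
by rewrite [X in torus_dist X _]uE torus_dist_transl.
Qed.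

(** A factor d turns the exponent x into x - 1, and d^(-s) turns it into x + s. Translation
    invariance lets the reverse links, normalised at [v], share the constant c(s) at [u]. *)
Lemma payoff_uniform (alpha : node k m.+1 -> R) u x s :
  payoff alpha u x (uniform_profile k m.+1 s) =
  (norm_const u (x - 1) / norm_const u x) `^ alpha u *
  (norm_const u (x + s) / norm_const u x) / norm_const u s.
Proof.
have dn0 v : v != u -> (torus_dist u v)%:R != 0 :> R.
  by move=> vu; rewrite pnatr_eq0 -lt0n torus_dist_gt0.
rewrite /payoff -mulrA; congr (_ `^ _ * _).
- rewrite /norm_const mulr_suml; apply: eq_bigr => v vu.
  rewrite /link_prob mulrAC; congr (_ / _).
  rewrite -[X in _ * X]powRr1 // -powRD ?(dn0 _ vu) ?implybT //.
  by congr (_ `^ _); ring.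
- rewrite /norm_const !mulr_suml; apply: eq_bigr => v vu.
  rewrite /link_prob /uniform_profile (norm_const_transl v u) (torus_distC v u).
  rewrite opprD powRD ?(dn0 _ vu) ?implybT // /norm_const.
  by rewrite mulrACA -!mulrA; congr (_ * (_ * _)); rewrite mulrC.
Qed.

Lemma torus_dist_powR_gt0 u v x : v != u -> 0 < (torus_dist u v)%:R `^ x :> R.
Proof. by move=> vu; rewrite powR_gt0 // ltr0n torus_dist_gt0. Qed.

Lemma torus_dist_ge1 u v : v != u -> 1 <= (torus_dist u v)%:R :> R.
Proof. by move=> vu; rewrite ler1n torus_dist_gt0. Qed.

Lemma torus_dist_powRD u v x y : v != u ->
  (torus_dist u v)%:R `^ (x + y) =
  (torus_dist u v)%:R `^ x * (torus_dist u v)%:R `^ y :> R.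
Proof.
by move=> vu; rewrite powRD // pnatr_eq0 -lt0n torus_dist_gt0 ?implybT.
Qed.

Lemma ler_norm_const u x y : x <= y -> norm_const u y <= norm_const u x.
Proof.
move=> xy; apply: ler_sum => v vu.
by apply: ler_powR; rewrite ?lerN2 ?torus_dist_ge1.
Qed.

Lemma norm_const_ge1 u x : (0 < k)%N -> (0 < m)%N -> 1 <= norm_const u x.
Proof.
move=> k0 m0; have [//|//|v vu d1] := @torus_dist_attained k m u 1 k0 _ _.
rewrite /norm_const (bigD1 v) //= d1 powR1 lerDl.
by apply: sumr_ge0 => w _; apply: powR_ge0.
Qed.

(** Both powers are nonincreasing in the base, so the two differences have the same sign, as
    Chebyshev's inequality requires. *)
Lemma powR_cross_ge0 p q : 0 <= p -> 0 <= q ->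
  forall a b : R, 1 <= a -> 1 <= b ->
  0 <= (a `^ (- p) - b `^ (- p)) * (a `^ (- q) - b `^ (- q)).
Proof.
have mono t (a b : R) : 0 <= t -> 1 <= a -> a <= b -> b `^ (- t) <= a `^ (- t).
  move=> t0 a1 ab; have a0 : 0 < a by lra.
  have b0 : 0 < b by lra.
  rewrite !powRN lef_pV2 ?posrE ?powR_gt0 //.
  by apply: ge0_ler_powR; rewrite ?nnegrE // ltW.
move=> p0 q0 a b a1 b1; have [ab|ba] := leP a b.
- by rewrite mulr_ge0 // subr_ge0 mono.
- by rewrite mulr_le0 // subr_le0 mono // ltW.
Qed.

Let norm_const_split u x p : norm_const u (x + p) =
  \sum_(v | v != u) (torus_dist u v)%:R `^ (- x) * (torus_dist u v)%:R `^ (- p).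
Proof. by apply: eq_bigr => v vu; rewrite opprD torus_dist_powRD. Qed.

Let norm_const_split2 u x p q : norm_const u (x + p + q) =
  \sum_(v | v != u) (torus_dist u v)%:R `^ (- x) *
    ((torus_dist u v)%:R `^ (- p) * (torus_dist u v)%:R `^ (- q)).
Proof.
by apply: eq_bigr => v vu; rewrite !opprD !torus_dist_powRD ?mulrA.
Qed.

(** Chebyshev's inequality with weights d^(-x) and functions d^(-p), d^(-q). *)
Lemma norm_const_log_convex u x p q : 0 <= p -> 0 <= q ->
  norm_const u (x + p) * norm_const u (x + q) <=
  norm_const u x * norm_const u (x + p + q).
Proof.
move=> p0 q0; rewrite !norm_const_split2 !norm_const_split.
apply: chebyshev_sum_le => [v vu|v w vu wu]; first exact: powR_ge0.
by rewrite powR_cross_ge0 ?torus_dist_ge1.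
Qed.

(** Strictness comes from two nodes at distances 1 and 2; a side of at least 4 provides the
    second. *)
Lemma norm_const_log_convex_lt u x p q : (0 < k)%N -> (3 <= m)%N ->
    0 < p -> 0 < q ->
  norm_const u (x + p) * norm_const u (x + q) <
  norm_const u x * norm_const u (x + p + q).
Proof.
move=> k0 m3 p0 q0; rewrite !norm_const_split2 !norm_const_split.
have [//||v vu d1] := @torus_dist_attained k m u 1 k0; first lia.
have [//||w wu d2] := @torus_dist_attained k m u 2 k0; first lia.
apply: (@chebyshev_sum_lt _ _ _ _ _ _ _ _ v w) => [i iu|i j iu ju|//|//| | |].
- exact: powR_ge0.
- by rewrite powR_cross_ge0 ?torus_dist_ge1 // ltW.
- exact: torus_dist_powR_gt0.
- exact: torus_dist_powR_gt0.
rewrite d1 d2 !powR1.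
have lt1 (t : R) : 0 < t -> 2 `^ (- t) < 1 :> R.
  move=> t0; rewrite powRN invf_lt1 ?powR_gt0 //.
  rewrite -[X in X < _](congr1 (@^~ t) (powR1 R)).
  by rewrite gt0_ltr_powR ?nnegrE // ltr1n.
by rewrite mulr_gt0 // subr_gt0 lt1.
Qed.

Lemma norm_const_shift_le u x t : 0 <= t ->
  norm_const u (x - t) <= (k * m.+1)%:R `^ t * norm_const u x.
Proof.
move=> t0; rewrite /norm_const mulr_sumr; apply: ler_sum => v vu.
rewrite opprB torus_dist_powRD // ler_wpM2r ?powR_ge0 //.
by apply: ge0_ler_powR; rewrite ?nnegrE ?ler_nat ?torus_dist_le.
Qed.

(* All n^k - 1 other nodes are within distance [k * n]. *)
Lemma norm_const_ge u x : (0 < k)%N -> (0 < m)%N -> 0 <= x -> x <= k%:R ->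
  m.+1%:R `^ (k%:R - x) / (2 * k%:R ^+ k) <= norm_const u x.
Proof.
move=> k0 m0 x0 xk.
have k1 : 1 <= k%:R :> R by rewrite ler1n.
apply: (@le_trans _ _ (\sum_(v | v != u) (k * m.+1)%:R `^ (- x))); last first.
  apply: ler_sum => v vu; rewrite !powRN.
  rewrite lef_pV2 ?posrE ?torus_dist_powR_gt0 ?powR_gt0 ?ltr0n ?muln_gt0 ?k0 //.
  by apply: ge0_ler_powR; rewrite ?nnegrE ?ler_nat ?torus_dist_le.
rewrite sumr_const cardC1 card_ffun !card_ord.
have half : m.+1%:R ^+ k / 2 <= (m.+1 ^ k).-1%:R :> R.
  rewrite ler_pdivrMr // -natrX -natrM ler_nat.
  have : (m.+1 ^ 1 <= m.+1 ^ k)%N by rewrite leq_pexp2l.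
  rewrite expn1; lia.
rewrite -[X in _ <= X]mulr_natr natrM powRM // powRB; last first.
  by rewrite pnatr_eq0 implybT.
rewrite powR_mulrn // -powRN invfM mulrACA mulrA mulrC.
have kx : (k%:R ^+ k)^-1 <= k%:R `^ (- x) :> R.
  by rewrite -powR_invn // ler_powR // lerN2.
have -> (a b c d : R) : a * (b * c * d) = a * d * (b * c) by ring.
apply: ler_pM => //; last by rewrite ler_wpM2r ?powR_ge0.
Qed.

End NormConst.

(** * Polylogarithmic growth of c(k) *)

Section HarmonicBound.

Variable R : realType.

Lemma sum_inv_le_ln n : \sum_(i < n.+1) i.+1%:R^-1 <= 1 + ln n.+1%:R :> R.
Proof.
elim: n => [|n IHn]; first by rewrite big_ord1 ln1 invr1 addr0.
rewrite big_ord_recr /= (le_trans (lerD IHn (lexx _))) // -addrA lerD2l.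
have n0 (i : nat) : i.+1%:R != 0 :> R by rewrite pnatr_eq0.
(* This is the induction step 1/(n+2) <= ln(n+2) - ln(n+1) in disguise. *)
have : ln (1 + - n.+2%:R^-1) <= - n.+2%:R^-1 :> R.
  by apply: le_ln1Dx; rewrite ltrN2 invf_lt1 // ltr1n.
have -> : 1 + - n.+2%:R^-1 = n.+1%:R / n.+2%:R :> R.
  by rewrite -[n.+1%:R in RHS](addrK 1) natr1 mulrBl divff // mul1r.
rewrite ln_div ?posrE //.
by move: (ln n.+1%:R) (ln n.+2%:R) (n.+2%:R^-1) => a b c; lra.
Qed.

(** Move [a] to 0. If the short way to j has length j, the term is at most 2/(j+1), which also
    covers j = 0; otherwise it is 1/(n+1-j), a term of the reversed harmonic sum. Hence 3 = 2 +
    1. *)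
Lemma sum_inv_circle_le n (a : 'I_n.+1) :
  \sum_(b < n.+1) (maxn 1 (minn `|a - b| (n.+1 - `|a - b|)))%:R^-1 <=
  3 * (1 + ln n.+1%:R) :> R.
Proof.
under eq_bigr do rewrite circle_distE.
rewrite (reindex_inj (addIr a)).
under eq_bigr do rewrite addrK.
apply: (@le_trans _ _ (\sum_(b < n.+1)
    (2 * b.+1%:R^-1 + (rev_ord b).+1%:R^-1))).
  apply: ler_sum => -[j jn] _ /=.
  have [bs|bl] := leqP (maxn 1 j) (n.+1 - j).
    rewrite -[leLHS]addr0 lerD ?invr_ge0 //.
    rewrite -[X in X * _]invrK -invfM.
    rewrite lef_pV2 ?posrE ?mulr_gt0 ?invr_gt0 ?ltr0n //; last lia.
    rewrite mulrC ler_pdivrMr // -natrM ler_nat; lia.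
  rewrite -[leLHS]add0r lerD ?mulr_ge0 ?invr_ge0 //.
  rewrite lef_pV2 ?posrE ?ltr0n ?ler_nat /=; lia.
rewrite big_split /= -mulr_sumr.
have <- : \sum_(i < n.+1) i.+1%:R^-1 =
    \sum_(i < n.+1) (rev_ord i).+1%:R^-1 :> R by apply: reindex_inj rev_ord_inj.
have := sum_inv_le_ln n; move: (\sum_(i < _) _) (ln _) => S l; lra.
Qed.

(* d is at least each [max(1, d_i)], where the [d_i] are the circle distances of
   the coordinates, so c(k) is at most the product of the one-dimensional sums
   of [1 / max(1, d_i)]. *)
Lemma norm_const_k_le k n (u : node k n.+1) :
  norm_const u k%:R <= (3 * (1 + ln n.+1%:R)) ^+ k :> R.
Proof.
pose h (i : 'I_k) (b : 'I_n.+1) : R :=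
  (maxn 1 (minn `|u i - b| (n.+1 - `|u i - b|)))%:R^-1.
have h0 i b : 0 <= h i b by rewrite invr_ge0.
apply: (@le_trans _ _ (\sum_(v : node k n.+1) \prod_i h i (v i))).
  rewrite [leRHS](bigID (fun v => v != u)) /= ler_wpDr //.
    by apply: sumr_ge0 => v _; apply: prodr_ge0.
  apply: ler_sum => v vu.
  rewrite powR_invn // -exprVn -[X in _ ^+ X]card_ord -prodr_const.
  apply: ler_prod => i _; rewrite invr_ge0 ler0n /=.
  rewrite lef_pV2 ?posrE ?ltr0n ?torus_dist_gt0 //; last lia.
  by rewrite ler_nat geq_max torus_dist_gt0 //= torus_dist_ge.
rewrite -(bigA_distr_bigA h) -[X in _ ^+ X]card_ord -prodr_const.
apply: ler_prod => i _; rewrite sumr_ge0 //=; exact: sum_inv_circle_le.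
Qed.

Lemma powR_ln_lt_powR (K C P e : R) : 0 <= K -> 0 <= C -> 0 <= P -> 0 < e ->
  exists n0 : nat, forall n : nat, (0 < n)%N -> (n0 <= n)%N ->
    K * (C * (1 + ln n%:R)) `^ P < n%:R `^ e.
Proof.
move=> K0 C0 P0 e0.
(* Applying ln y < y to y = n^d bounds ln n by n^d / d. This [d] gives d P <= e/2, which leaves
   n^(e/2) to absorb the constant [M]. *)
pose d := e / (2 * (P + 1)); have d0 : 0 < d by rewrite divr_gt0 //; lra.
pose M := K * (C * (1 + d^-1)) `^ P.
have M0 : 0 <= M by rewrite mulr_ge0 ?powR_ge0.
(* Beyond this threshold, M < n^(e/2). *)
exists (Num.bound (M `^ (e / 2)^-1)) => n n0 nM.
have n1 : 1 <= n%:R :> R by rewrite ler1n.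
have lnn : 1 + ln n%:R <= (1 + d^-1) * n%:R `^ d.
  have nd : 1 <= n%:R `^ d by rewrite -[leLHS](powRr0 n%:R) ler_powR // ltW.
  have : d * ln n%:R <= n%:R `^ d.
    by rewrite -ln_powR ltW // ln_sublinear ?powR_gt0 ?ltr0n.
  rewrite -ler_pdivlMl // mulrDl mul1r; lra.
have l0 : 0 <= 1 + ln n%:R :> R by rewrite addr_ge0 // ln_ge0.
have le1 : K * (C * (1 + ln n%:R)) `^ P <= M * n%:R `^ (d * P).
  rewrite /M -mulrA ler_wpM2l // powRrM -powRM ?powR_ge0 //; last first.
    by rewrite mulr_ge0 // addr_ge0 // invr_ge0 ltW.
  apply: ge0_ler_powR => //; rewrite ?nnegrE ?mulr_ge0 ?powR_ge0 //.
    by rewrite addr_ge0 // invr_ge0 ltW.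
  by rewrite -mulrA ler_wpM2l.
have dP : d * P <= e / 2.
  rewrite /d mulrAC ler_pdivrMr; last lra.
  have -> : e / 2 * (2 * (P + 1)) = e * P + e by field.
  lra.
apply: le_lt_trans le1 _.
apply: (@le_lt_trans _ _ (M * n%:R `^ (e / 2))).
  by rewrite ler_wpM2l // ler_powR.
have -> : e = e / 2 + e / 2 by field.
rewrite powRD; last by rewrite pnatr_eq0 -lt0n n0 implybT.
have e20 : 0 < e / 2 by rewrite divr_gt0.
(* Splitting [e] also rewrote the [e] inside the exponent on the left; this restores it. *)
have -> : (e / 2 + e / 2) / 2 = e / 2 by field.
rewrite ltr_pM2r ?powR_gt0 ?ltr0n //.
have := archi_boundP (powR_ge0 M (e / 2)^-1).
move=> /lt_le_trans -/(_ n%:R); rewrite ler_nat => /(_ nM) lt1.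
have := gt0_ltr_powR e20 _ _ lt1; rewrite -powRrM mulVf ?gt_eqF // powRr1 //.
by apply; rewrite nnegrE ?powR_ge0.
Qed.

End HarmonicBound.

(** * Strategy k beats all others against a uniform profile s > 0 *)

Section BestResponse.

Variables (R : realType) (k m : nat) (u : node k m.+1).
Variables (a amin amax gamma s : R).
Hypotheses (k0 : (0 < k)%N) (m0 : (0 < m)%N).
Hypotheses (gamma0 : 0 < gamma) (gamma1 : gamma <= 1) (gammas : gamma <= s).
Hypotheses (amin0 : 0 < amin) (amina : amin <= a) (aamax : a <= amax).

(** The constant of [norm_const_ge]: c(x) >= N^(k - x) / Q for 0 <= x <= k. *)
Let Q : R := 2 * k%:R ^+ k.
Let N : R := m.+1%:R.
Let L : R := norm_const u k%:R.

(** One condition serves both sides of k. Its left exponents dominate those met below, and the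
    minimum covers a loss of N^gamma (x below k) as well as N^(gamma a) (x above k). It involves [a]
    only through its bounds. *)
Hypothesis L_small :
  (k%:R * Q) `^ (amax + 1) * L `^ (2 * amax + 2) <
  N `^ (gamma * Num.min 1 amin).

(** The payoff without its factor 1/c(s), which is the same for all x. *)
Let relative_payoff (x : R) : R :=
  (norm_const u (x - 1) / norm_const u x) `^ a *
  (norm_const u (x + s) / norm_const u x).

Let k1 : 1 <= k%:R :> R. Proof. by rewrite ler1n. Qed.
Let N1 : 1 <= N. Proof. by rewrite ler1n. Qed.
Let L1 : 1 <= L. Proof. exact: norm_const_ge1. Qed.
Let a0 : 0 < a. Proof. exact: lt_le_trans amin0 amina. Qed.
Let Q1 : 1 <= Q.
Proof. by have := exprn_ege1 k k1; rewrite /Q; lra. Qed.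
Let kQ1 : 1 <= k%:R * Q. Proof. exact: mulr_ege1. Qed.
Let c_gt0 (x : R) : 0 < norm_const u x.
Proof. exact: lt_le_trans (norm_const_ge1 u x k0 m0). Qed.

(* The lower bound for the mean link length of k, to the power alpha. *)
Let base := (N / (Q * L)) `^ a.

Let N0 : 0 < N. Proof. exact: lt_le_trans N1. Qed.
Let L0 : 0 < L. Proof. exact: lt_le_trans L1. Qed.
Let Q0 : 0 < Q. Proof. exact: lt_le_trans Q1. Qed.
Let kR0 : 0 < k%:R :> R. Proof. exact: lt_le_trans k1. Qed.
Let QL0 : 0 < Q * L. Proof. exact: mulr_gt0. Qed.
Let kN0 : 0 < k%:R * N. Proof. exact: mulr_gt0. Qed.
Let kQ0 : 0 < k%:R * Q. Proof. exact: mulr_gt0. Qed.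
Let NQL0 : 0 < N / (Q * L). Proof. exact: divr_gt0. Qed.
Let Ng0 : 0 < N `^ gamma. Proof. exact: powR_gt0. Qed.
Let mean_ge0 (x : R) : 0 <= norm_const u (x - 1) / norm_const u x.
Proof. exact: divr_ge0 (ltW (c_gt0 _)) (ltW (c_gt0 _)). Qed.
Let meet_ge0 (x : R) : 0 <= norm_const u (x + s) / norm_const u x.
Proof. exact: divr_ge0 (ltW (c_gt0 _)) (ltW (c_gt0 _)). Qed.
Let base0 : 0 < base. Proof. exact: powR_gt0. Qed.

Let growth p q r : p <= amax + 1 -> q <= 2 * amax + 2 ->
  gamma * Num.min 1 amin <= r -> (k%:R * Q) `^ p * L `^ q < N `^ r.
Proof.
move=> pA qA rg; apply: le_lt_trans (lt_le_trans L_small _).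
  by rewrite ler_pM ?powR_ge0 // ler_powR.
by rewrite ler_powR.
Qed.

(** The meeting factor is at least 1/L because c >= 1; the mean link length uses c(k - 1) >= N /
    Q. *)
Lemma relative_payoff_k_ge : base / L <= relative_payoff k%:R.
Proof.
rewrite ler_pM ?invr_ge0 ?(ltW L0) ?(ltW base0) //; last first.
  by rewrite -[leLHS]mul1r ler_pM2r ?invr_gt0 // norm_const_ge1.
apply: ge0_ler_powR; rewrite ?nnegrE ?(ltW a0) //.
- exact: ltW NQL0.
- rewrite invfM mulrA ler_pM2r ?invr_gt0 //.
  have := @norm_const_ge R k m u (k%:R - 1) k0 m0.
  rewrite subKr powRr1 //; apply; have := k1; lra.
Qed.

Lemma relative_payoff_lt_k_below x : 0 <= x -> x <= k%:R - gamma ->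
  relative_payoff x < relative_payoff k%:R.
Proof.
move=> x0 xk; apply: lt_le_trans relative_payoff_k_ge.
have mean_le : norm_const u (x - 1) / norm_const u x <= k%:R * N.
  rewrite ler_pdivrMr // -natrM -[X in X * _]powRr1 //.
  exact: norm_const_shift_le.
have meet_le : norm_const u (x + s) / norm_const u x <= L * (Q / N `^ gamma).
  rewrite ler_pdivrMr //.
  apply: (@le_trans _ _ (norm_const u (x + gamma))).
    by rewrite ler_norm_const // lerD2l.
  (* Log-convexity with shifts gamma and k - gamma - x gives c(x + gamma) c(k - gamma) <= c(x)
     c(k). *)
  have :=
    @norm_const_log_convex R k m u x gamma (k%:R - gamma - x) (ltW gamma0).
  have -> : x + gamma + (k%:R - gamma - x) = k%:R by ring.
  have -> : x + (k%:R - gamma - x) = k%:R - gamma by ring.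
  rewrite -/L subr_ge0 => /(_ xk); rewrite -ler_pdivlMr // => /le_trans; apply.
  rewrite [leRHS]mulrC -mulrA ler_pM2l // ler_pM2l //.
  rewrite -[leRHS]invf_div lef_pV2 ?posrE ?divr_gt0 ?powR_gt0 //.
  have := @norm_const_ge R k m u (k%:R - gamma) k0 m0.
  rewrite subKr ; apply; have := k1; have := gamma0; have := gamma1; lra.
have lhs_le : relative_payoff x <= (k%:R * N) `^ a * (L * (Q / N `^ gamma)).
  rewrite ler_pM ?powR_ge0 ?meet_ge0 //.
  by apply: ge0_ler_powR mean_le; rewrite ?nnegrE ?mean_ge0 // ltW.
apply: le_lt_trans lhs_le _.
(* Exposes [base] so that it cancels, leaving only powers of [k%:R * Q] and [L] against N^gamma. *)
have -> : k%:R * N = k%:R * Q * L * (N / (Q * L)).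
  by field; rewrite !gt_eqF.
rewrite powRM ?(ltW NQL0) ?(ltW (mulr_gt0 kQ0 L0)) // -/base.
rewrite mulrC mulrCA mulrA [X in X < _]mulrC mulrA.
rewrite ltr_pM2l // mulrA ltr_pdivrMr // [ltRHS]mulrC ltr_pdivlMr //.
(* The single factor Q is enlarged to k Q to merge with the power of k Q. *)
apply: (@le_lt_trans _ _ ((k%:R * Q) `^ (a + 1) * L `^ (a + 2))).
  rewrite (@powRD _ _ a 1) ?(gt_eqF kQ0) ?implybT // powRr1 ?(ltW kQ0) //.
  rewrite (@powRD _ _ a 2) ?(gt_eqF L0) ?implybT // powR_mulrn ?(ltW L0) //.
  rewrite powRM ?(ltW kQ0) ?(ltW L0) //.
  have -> : (k%:R * Q) `^ a * L `^ a * (L * Q) * L =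
      (k%:R * Q) `^ a * Q * (L `^ a * L ^+ 2) by ring.
  rewrite ler_wpM2r ?mulr_ge0 ?powR_ge0 ?exprn_ge0 ?(ltW L0) //.
  by rewrite ler_wpM2l ?powR_ge0 // ler_peMl ?(ltW Q0).
apply: growth; [by have := aamax; lra|by have := aamax; have := a0; lra|].
by rewrite -[leRHS]mulr1 ler_pM2l // ge_min lexx.
Qed.

Lemma relative_payoff_lt_k_above x : k%:R + gamma <= x ->
  relative_payoff x < relative_payoff k%:R.
Proof.
move=> xk; apply: lt_le_trans relative_payoff_k_ge.
have mean_le :
    norm_const u (x - 1) / norm_const u x <= k%:R * N * L / N `^ gamma.
  apply: (@le_trans _ _ (norm_const u (x - 1))).
    by rewrite ler_pdivrMr // ler_peMr ?norm_const_ge1 // ltW.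
  (* Since x - 1 >= k - (1 - gamma), only a shift by 1 - gamma below k is paid for, which is where
     N^gamma is saved. *)
  apply: (@le_trans _ _ (norm_const u (k%:R - (1 - gamma)))).
    by rewrite ler_norm_const // opprB addrA lerD2r.
  apply: le_trans (norm_const_shift_le _ _ _) _; first by rewrite subr_ge0.
  rewrite -/L [leRHS]mulrAC ler_pM2r // natrM powRB; last first.
    by rewrite (gt_eqF kN0) implybT.
  rewrite powRr1 ?(ltW kN0) // ler_pM2l //.
  rewrite lef_pV2 ?posrE ?powR_gt0 //.
  apply: ge0_ler_powR; rewrite ?nnegrE ?(ltW kN0) ?(ltW N0) ?(ltW gamma0) //.
  by rewrite ler_peMl // ltW.
have lhs_le : relative_payoff x <= (k%:R * N * L / N `^ gamma) `^ a.
  rewrite -[leRHS]mulr1 ler_pM ?powR_ge0 ?meet_ge0 //; last first.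
    rewrite ler_pdivrMr // mul1r ler_norm_const //.
    by rewrite lerDl (le_trans (ltW gamma0)).
  apply: (ge0_ler_powR (ltW a0) _ _ mean_le); rewrite nnegrE ?mean_ge0 //.
  exact: le_trans (mean_ge0 _) mean_le.
apply: le_lt_trans lhs_le _.
have -> : k%:R * N * L / N `^ gamma =
    k%:R * Q * L ^+ 2 / N `^ gamma * (N / (Q * L)).
  by field; rewrite !gt_eqF // powR_gt0.
have kQL2_0 : 0 < k%:R * Q * L ^+ 2 by rewrite mulr_gt0 // exprn_gt0.
rewrite powRM ?(ltW NQL0) ?(ltW (divr_gt0 kQL2_0 Ng0)) // -/base.
rewrite [ltRHS]mulrC ltr_pM2r //.
rewrite (powRM _ (ltW kQL2_0)) ?invr_ge0 ?(ltW Ng0) //.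
rewrite (powRM _ (ltW kQ0) (ltW (exprn_gt0 2 L0))).
rewrite -powRN -powR_mulrn ?(ltW L0) // -!powRrM mulNr powRN.
rewrite ltr_pdivrMr ?powR_gt0 // [ltRHS]mulrC ltr_pdivlMr //.
apply: (@le_lt_trans _ _ ((k%:R * Q) `^ a * L `^ (2 * a + 1))).
  rewrite (@powRD _ _ (2 * a)) ?(gt_eqF L0) ?implybT //.
  by rewrite powRr1 ?(ltW L0) // mulrA.
apply: growth; [by have := aamax; lra|by have := aamax; lra|].
by rewrite ler_pM2l // ge_min amina orbT.
Qed.

End BestResponse.

(** * Discrete strategies and the equilibria among uniform profiles *)

Section UniformProfiles.

Variables (R : realType) (k m g : nat) (alpha : node k m.+1 -> R).
Hypotheses (k0 : (0 < k)%N) (g0 : (0 < g)%N).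

Lemma strategies_ge0 (x : R) : strategies g%:R^-1 x -> 0 <= x.
Proof. by case=> j ->; rewrite mulr_ge0 ?invr_ge0. Qed.

Lemma strategies_nat j : strategies g%:R^-1 (j%:R : R).
Proof. by exists (j * g)%N; rewrite natrM mulfK // pnatr_eq0 -lt0n. Qed.

(** Both x and j are integer multiples of 1/g, and distinct integers differ by at least 1. *)
Lemma strategies_gap (j : nat) (x : R) : strategies g%:R^-1 x -> x <> j%:R ->
  x <= j%:R - g%:R^-1 \/ j%:R + g%:R^-1 <= x.
Proof.
have gR0 : 0 < g%:R :> R by rewrite ltr0n.
have -> : j%:R = (j * g)%:R * g%:R^-1 :> R by rewrite natrM mulfK ?gt_eqF.
case=> i -> ij.
have {}ij : i != (j * g)%N by apply/eqP => h; apply: ij; rewrite h.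
have -> : (j * g)%:R * g%:R^-1 - g%:R^-1 = ((j * g)%:R - 1) * g%:R^-1 :> R.
  by rewrite mulrBl mul1r.
have -> : (j * g)%:R * g%:R^-1 + g%:R^-1 = ((j * g)%:R + 1) * g%:R^-1 :> R.
  by rewrite mulrDl mul1r.
rewrite !ler_pM2r ?invr_gt0 // lerBrDr !natr1 !ler_nat.
by move: ij; rewrite neq_ltn => /orP[]; [left|right].
Qed.

Lemma payoff_lt_k u (amin amax s x : R) : (0 < m)%N -> 0 < amin ->
    amin <= alpha u -> alpha u <= amax ->
    (k%:R * (2 * k%:R ^+ k)) `^ (amax + 1) *
      norm_const u k%:R `^ (2 * amax + 2) <
      m.+1%:R `^ (g%:R^-1 * Num.min 1 amin) ->
    strategies g%:R^-1 s -> s <> 0 -> strategies g%:R^-1 x -> x <> k%:R ->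
  payoff alpha u x (uniform_profile k m.+1 s) <
  payoff alpha u k%:R (uniform_profile k m.+1 s).
Proof.
move=> m0 amin0 amina aamax small s_strat s0 x_strat xk.
have gamma0 : 0 < g%:R^-1 :> R by rewrite invr_gt0 ltr0n.
have gamma1 : g%:R^-1 <= 1 :> R by rewrite invf_le1 ?ltr0n // ler1n.
have gammas : g%:R^-1 <= s.
  have [] := strategies_gap (j := 0) s_strat s0; last by rewrite add0r.
  have := strategies_ge0 s_strat; lra.
rewrite !payoff_uniform ltr_pM2r; last first.
  by rewrite invr_gt0 (lt_le_trans _ (norm_const_ge1 u s k0 m0)).
have [xle|xge] := strategies_gap x_strat xk.
- by apply: relative_payoff_lt_k_below small _ _ _ => //; apply: strategies_ge0.
- by apply: relative_payoff_lt_k_above small _ _.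
Qed.

Lemma payoff_lt_0 u (x : R) : (3 <= m)%N -> 0 < alpha u -> 0 < x ->
  payoff alpha u x (uniform_profile k m.+1 0) <
  payoff alpha u 0 (uniform_profile k m.+1 0).
Proof.
move=> m3 a0 x0; have m0 : (0 < m)%N by apply: leq_trans m3.
have c0 (y : R) : 0 < norm_const u y.
  exact: lt_le_trans (norm_const_ge1 u y k0 m0).
rewrite !payoff_uniform !addr0 !divff ?(gt_eqF (c0 _)) // !mulr1.
rewrite ltr_pM2r ?invr_gt0 //; apply: gt0_ltr_powR => //.
- by rewrite nnegrE divr_ge0 ?ltW.
- by rewrite nnegrE divr_ge0 ?ltW.
rewrite ltr_pdivrMr // mulrAC ltr_pdivlMr // sub0r.
(* From base point -1 with shifts x and 1: c(x - 1) c(0) < c(-1) c(x), a comparison of mean link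
   lengths. *)
have := norm_const_log_convex_lt u (-1) k0 m3 x0 ltr01.
by rewrite addNr [-1 + x]addrC subrK.
Qed.

End UniformProfiles.

(** The node set varies with n, so the threshold depends on the exponents through bounds common to
    all nodes. *)
Theorem corollary3p1 (R : realType) (k g : nat) (alpha_min alpha_max : R)
    (hk : (1 <= k)%N) (hg : (2 <= g)%N) (halpha : 0 < alpha_min) :
  exists n0 : nat, forall n : nat, (2 <= n)%N -> (n0 <= n)%N ->
    forall alpha : node k n -> R,
      (forall u, alpha_min <= alpha u <= alpha_max) ->
    [/\ strict_nash g%:R^-1 alpha (uniform_profile k n k%:R),
        strict_nash g%:R^-1 alpha (uniform_profile k n 0) &
        forall s : R, strategies g%:R^-1 s -> s <> 0 -> s <> k%:R ->
          ~ nash g%:R^-1 alpha (uniform_profile k n s)].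
Proof.
(* The threshold is fixed before any [alpha] is given, when the sign of [alpha_max] is still
   unknown; hence the absolute value. *)
set K := (k%:R * (2 * k%:R ^+ k)) `^ (`|alpha_max| + 1) : R.
set e := g%:R^-1 * Num.min 1 alpha_min : R.
have g0 : (0 < g)%N by apply: ltnW.
have e0 : 0 < e.
  by rewrite mulr_gt0 ?invr_gt0 ?ltr0n // lt_min ltr01.
(* The exponent of the logarithm: k from the bound on c(k), times the power of c(k) in the growth
   condition. *)
have P0 : 0 <= k%:R * (2 * `|alpha_max| + 2) :> R.
  by rewrite mulr_ge0 // addr_ge0 // mulr_ge0.
have [n0 n0P] := powR_ln_lt_powR (powR_ge0 _ _ : 0 <= K) (ler0n R 3) P0 e0.
exists (maxn 4 n0) => n _; rewrite geq_max => /andP[n4 nn0] alpha alphaP.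
case: n n4 nn0 alpha alphaP => // m m3 nn0 alpha alphaP.
have m0 : (0 < m)%N by lia.
have small (u : node k m.+1) :
    K * norm_const u k%:R `^ (2 * `|alpha_max| + 2) < m.+1%:R `^ e.
  apply: le_lt_trans (n0P m.+1 isT nn0); rewrite ler_wpM2l ?powR_ge0 //.
  have l0 : 0 <= 3 * (1 + ln m.+1%:R) :> R.
    by rewrite mulr_ge0 // addr_ge0 // ln_ge0 // ler1n.
  rewrite powRrM powR_mulrn //; apply: ge0_ler_powR.
  - by rewrite addr_ge0 // mulr_ge0.
  - by rewrite nnegrE (le_trans _ (norm_const_ge1 u _ hk m0)).
  - by rewrite nnegrE exprn_ge0.
  - exact: norm_const_k_le.
have k_wins (u : node k m.+1) (s x : R) : strategies g%:R^-1 s -> s <> 0 ->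
    strategies g%:R^-1 x -> x <> k%:R ->
    payoff alpha u x (uniform_profile k m.+1 s) <
    payoff alpha u k%:R (uniform_profile k m.+1 s).
  have /andP[alow ahigh] := alphaP u.
  by apply: payoff_lt_k (le_trans ahigh (ler_norm _)) (small u).
have k_strat : strategies g%:R^-1 (k%:R : R) := strategies_nat R g0 k.
have kN0 : k%:R <> 0 :> R by apply/eqP; rewrite pnatr_eq0 -lt0n.
have strict s : strategies g%:R^-1 s ->
    (forall u (x : R), strategies g%:R^-1 x -> x <> s ->
      payoff alpha u x (uniform_profile k m.+1 s) <
      payoff alpha u s (uniform_profile k m.+1 s)) ->
    strict_nash g%:R^-1 alpha (uniform_profile k m.+1 s).
  move=> s_strat s_wins.
  have s_best u : best_response g%:R^-1 alpha (uniform_profile k m.+1 s) u s.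
    split=> // y y_strat; have [->//|/eqP ys] := eqVneq y s.
    exact: ltW (s_wins u y y_strat ys).
  by split=> // u; split=> // y; apply: s_wins.
split.
- by apply: strict => // u x; apply: k_wins.
- apply: strict => [|u x x_strat x0]; first by exists 0%N; rewrite mul0r.
  have /andP[alow _] := alphaP u.
  apply: payoff_lt_0 => //; first exact: lt_le_trans alow.
  by rewrite lt_neqAle eq_sym (introN eqP x0) (strategies_ge0 x_strat).
(* The player at the origin gains strictly by deviating from s to k. *)
- move=> s s_strat s0 sk /(_ [ffun=> 0]) [_ /(_ _ k_strat)].
  by rewrite leNgt k_wins.
Qed.
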